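(* Let $n\ge 1$. The inverses of the lower triangular matrices \[ \big(h_{2m-k}(\{1,q\}^{k-m+1})\big)_{0\leq k,m\leq n},\quad (c_{k,m}(q))_{1\leq k,m\leq n},\quad (g_{k,m}(q))_{1\leq k,m\leq n},\quad (d_{k,m}(q))_{1\leq k,m\leq n} \] (row index $k$, column index $m$) are, respectively, the lower triangular matrices whose $(k,m)$ entries for $k\ge m$ are \begin{align*} &(-1)^{k-m}\frac{[m]!}{[k+1]!}P_{k,k-m}(q) \quad (0\le m\le k\le n),\\ &(-1)^{k-m}\frac{(1-q)^{k-m+1}Q_{k,k-m}(q)}{\prod_{i=0}^{k-m}(1-q^{2k-2i+1})}\quad (1\le m\le k\le n),\\ &(-1)^{k-m}\frac{G_{k,k-m}(q)}{\prod_{i=0}^{k-m}(1+q^{k-i})}\quad (1\le m\le k\le n),\\ &(-1)^{k-m}\frac{H_{k,k-m}(q)}{(1+q)^{k-m+1}\prod_{i=0}^{k-m}(1+q^{2k-2i-1})}\quad (1\le m\le k\le n). \end{align*}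
   Context: $q$ is an indeterminate with square root $q^{1/2}$; $[k]=\frac{1-q^k}{1-q}$, $[k]!=\prod_{i=1}^k[i]$, $[0]!=1$. For integers $r,s\ge 0$, $h_n(\{1\}^r,\{x\}^s)$ is defined by $\sum_{n\geq0}h_n(\{1\}^r,\{x\}^s)z^n=\frac{1}{(1-z)^r(1-xz)^s}$ (so $h_n=0$ for $n<0$), with $h_n=0$ if $r<0$ or $s<0$; $h_n(\{1,x\}^r):=h_n(\{1\}^r,\{x\}^r)$. For integers $k,m$: $c_{k,m}(q)=h_{2m-k}(\{1,q^2\}^{k-m+1})+q\,h_{2m-k-1}(\{1,q^2\}^{k-m+1})$, $g_{k,m}(q)=h_{2m-k}(\{1\}^{k-m+1},\{q\}^{k-m})+h_{2m-k}(\{1\}^{k-m},\{q\}^{k-m+1})$, $d_{k,m}(q)=g_{k,m}(q^2)+q\,g_{k-1,m-1}(q^2)$. Let $S_{m,n}(q)=\sum_{k=1}^n\frac{[2k]}{[2]}[k]^{m-1}q^{\frac{m+1}{2}(n-k)}$ and $T_{m,n}(q)=\sum_{k=1}^n(-1)^{n-k}[k]^mq^{\frac m2(n-k)}$. The polynomials $P_{m,j},Q_{m,j},G_{m,j},H_{m,j}\in\mathbb{Z}[q]$ are those (shown to exist by Guo and Zeng, and uniquely determined) such that for all $n\ge1$: $S_{2m+1,n}(q)=\sum_{k=0}^m(-q^n)^{m-k}\frac{[k]!}{[m+1]!}P_{m,m-k}(q)\frac{([n][n+1])^{k+1}}{[2]}$ for $m\ge0$; $S_{2m,n}(q)=(1-q^{n+\frac12})\sum_{k=0}^m(-q^n)^{m-k}\frac{(1-q^{\frac12})^{m-k}Q_{m,m-k}(q^{\frac12})}{\prod_{i=0}^{m-k}(1-q^{m-i+\frac12})}\frac{([n][n+1])^k}{[2]}$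 for $m\ge1$; $T_{2m,n}(q)=\sum_{k=1}^m(-q^n)^{m-k}\frac{G_{m,m-k}(q)}{\prod_{i=0}^{m-k}(1+q^{m-i})}([n][n+1])^k$ for $m\ge1$; $T_{2m-1,n}(q)=(-1)^{m+n}H_{m,m-1}(q^{\frac12})\frac{q^{(m-\frac12)n}}{(1+q^{\frac12})^m\prod_{i=0}^{m-1}(1+q^{m-i-\frac12})}+\frac{1-q^{n+\frac12}}{1-q^{\frac12}}\sum_{k=1}^m(-q^n)^{m-k}\frac{H_{m,m-k}(q^{\frac12})([n][n+1])^{k-1}}{(1+q^{\frac12})^{m-k+1}\prod_{i=0}^{m-k}(1+q^{m-i-\frac12})}$ for $m\ge1$. *)

(* Defs.v *)
From HB Require Import structures.
From mathcomp Require Import all_boot all_order all_algebra fraction.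
Set Implicit Arguments. Unset Strict Implicit. Unset Printing Implicit Defensive.
Import Order.TTheory GRing.Theory Num.Theory.
Local Open Scope ring_scope.

(* The base field: rational functions in the indeterminate s = q^(1/2),
   with integer coefficients; q := s^2. *)
Definition F : fieldType := {fraction {poly int}}.
Definition sq : F := tofrac ('X : {poly int}).
Definition qq : F := sq ^+ 2.

Definition ev (p : {poly int}) (x : F) : F :=
  (map_poly (fun z : int => z%:~R) p).[x].

Definition qint (q : F) (k : nat) : F := (1 - q ^+ k) / (1 - q).
Definition qfact (q : F) (k : nat) : F := \prod_(1 <= i < k.+1) qint q i.

(* h_n({1}^r,{x}^s) = coefficient of z^n in 1/((1-z)^r (1-xz)^s),
   computed from the truncated geometric series (truncation at degree n
   does not affect the coefficient of z^n). *)
Definition hnat (R : comNzRingType) (n r s : nat) (x : R) : R :=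
  (((\sum_(i < n.+1) 'X^i) ^+ r) *
   ((\sum_(j < n.+1) (x ^+ j) *: 'X^j) ^+ s) : {poly R})`_n.

Definition hh (R : comNzRingType) (n r s : int) (x : R) : R :=
  match n, r, s with
  | Posz n', Posz r', Posz s' => hnat n' r' s' x
  | _, _, _ => 0
  end.

Definition hh2 (R : comNzRingType) (n r : int) (x : R) : R := hh n r r x.

Definition cc (q : F) (k m : int) : F :=
  hh2 (2 * m - k) (k - m + 1) (q ^+ 2)
  + q * hh2 (2 * m - k - 1) (k - m + 1) (q ^+ 2).

Definition gg (q : F) (k m : int) : F :=
  hh (2 * m - k) (k - m + 1) (k - m) q + hh (2 * m - k) (k - m) (k - m + 1) q.

Definition dd (q : F) (k m : int) : F :=
  gg (q ^+ 2) k m + q * gg (q ^+ 2) (k - 1) (m - 1).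

(* S_{m,n}(q) and T_{m,n}(q), with q^{a/2} written as s^a, s = q^(1/2) *)
Definition Ssum (m n : nat) : F :=
  \sum_(1 <= k < n.+1)
    qint qq (2 * k)%N / qint qq 2 * qint qq k ^+ m.-1 * sq ^+ ((m + 1) * (n - k))%N.

Definition Tsum (m n : nat) : F :=
  \sum_(1 <= k < n.+1) (-1) ^+ (n - k)%N * qint qq k ^+ m * sq ^+ (m * (n - k))%N.

Definition NN (n : nat) : F := qint qq n * qint qq n.+1.

(* The defining identities of P, Q, G, H (Guo--Zeng). *)
Definition P_spec (P : nat -> nat -> {poly int}) : Prop :=
  forall m n : nat, (1 <= n)%N ->
    Ssum (2 * m + 1)%N n =
    \sum_(0 <= k < m.+1)
      (- qq ^+ n) ^+ (m - k)%N * (qfact qq k / qfact qq m.+1)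
      * ev (P m (m - k)%N) qq * NN n ^+ k.+1 / qint qq 2.

Definition Q_spec (Q : nat -> nat -> {poly int}) : Prop :=
  forall m n : nat, (1 <= m)%N -> (1 <= n)%N ->
    Ssum (2 * m)%N n =
    (1 - sq ^+ (2 * n + 1)%N) *
    \sum_(0 <= k < m.+1)
      (- qq ^+ n) ^+ (m - k)%N
      * ((1 - sq) ^+ (m - k)%N * ev (Q m (m - k)%N) sq
         / \prod_(0 <= i < (m - k).+1%N) (1 - sq ^+ (2 * (m - i) + 1)%N))
      * NN n ^+ k / qint qq 2.

Definition G_spec (G : nat -> nat -> {poly int}) : Prop :=
  forall m n : nat, (1 <= m)%N -> (1 <= n)%N ->
    Tsum (2 * m)%N n =
    \sum_(1 <= k < m.+1)
      (- qq ^+ n) ^+ (m - k)%N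
      * (ev (G m (m - k)%N) qq / \prod_(0 <= i < (m - k).+1%N) (1 + qq ^+ (m - i)%N))
      * NN n ^+ k.

Definition H_spec (H : nat -> nat -> {poly int}) : Prop :=
  forall m n : nat, (1 <= m)%N -> (1 <= n)%N ->
    Tsum (2 * m - 1)%N n =
    (-1) ^+ (m + n)%N * ev (H m (m - 1)%N) sq * sq ^+ ((2 * m - 1) * n)%N
      / ((1 + sq) ^+ m * \prod_(0 <= i < m) (1 + sq ^+ (2 * (m - i) - 1)%N))
    + (1 - sq ^+ (2 * n + 1)%N) / (1 - sq) *
      \sum_(1 <= k < m.+1)
        (- qq ^+ n) ^+ (m - k)%N * ev (H m (m - k)%N) sq * NN n ^+ (k - 1)%N
        / ((1 + sq) ^+ (m - k + 1)%N
           * \prod_(0 <= i < (m - k).+1%N) (1 + sq ^+ (2 * (m - i) - 1)%N)).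

(* The matrices.  Matrix 1 is indexed by 0..n (index i <-> k = i);
   matrices 2-4 are indexed by 1..n (index i : 'I_n <-> k = i+1). *)
Definition Hmx (n : nat) : 'M[F]_(n.+1) :=
  \matrix_(i, j) hh2 (2 * (j : nat)%:Z - (i : nat)%:Z) ((i : nat)%:Z - (j : nat)%:Z + 1) qq.

Definition Pinv (P : nat -> nat -> {poly int}) (n : nat) : 'M[F]_(n.+1) :=
  \matrix_(i, j) if (j <= i)%N then
      (-1) ^+ (i - j)%N * (qfact qq j / qfact qq i.+1) * ev (P i (i - j)%N) qq
    else 0.

Definition Cmx (n : nat) : 'M[F]_n :=
  \matrix_(i, j) cc qq (i.+1 : nat)%:Z (j.+1 : nat)%:Z.

Definition Qinv (Q : nat -> nat -> {poly int}) (n : nat) : 'M[F]_n :=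
  \matrix_(i, j) if (j <= i)%N then
      (-1) ^+ (i - j)%N *
      ((1 - qq) ^+ (i - j + 1)%N * ev (Q i.+1 (i - j)%N) qq
       / \prod_(0 <= l < (i - j).+1%N) (1 - qq ^+ (2 * i.+1 - 2 * l + 1)%N))
    else 0.

Definition Gmx (n : nat) : 'M[F]_n :=
  \matrix_(i, j) gg qq (i.+1 : nat)%:Z (j.+1 : nat)%:Z.

Definition Ginv (G : nat -> nat -> {poly int}) (n : nat) : 'M[F]_n :=
  \matrix_(i, j) if (j <= i)%N then
      (-1) ^+ (i - j)%N *
      (ev (G i.+1 (i - j)%N) qq / \prod_(0 <= l < (i - j).+1%N) (1 + qq ^+ (i.+1 - l)%N))
    else 0.

Definition Dmx (n : nat) : 'M[F]_n :=
  \matrix_(i, j) dd qq (i.+1 : nat)%:Z (j.+1 : nat)%:Z.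

Definition Hinv (H : nat -> nat -> {poly int}) (n : nat) : 'M[F]_n :=
  \matrix_(i, j) if (j <= i)%N then
      (-1) ^+ (i - j)%N *
      (ev (H i.+1 (i - j)%N) qq
       / ((1 + qq) ^+ (i - j + 1)%N
          * \prod_(0 <= l < (i - j).+1%N) (1 + qq ^+ (2 * i.+1 - 2 * l - 1)%N)))
    else 0.

Definition is_inverse (m : nat) (A B : 'M[F]_m) : Prop :=
  A *m B = 1%:M /\ B *m A = 1%:M.

(* Main.v *)
(* Put t_n = [n][n+1] q^-n and u_n = [n]^2 q^-n.  Then
     t_n + t_{n-1} = (1 + q) u_n  and  t_n t_{n-1} = q u_n^2 - u_n,
   and the row sums sum_m h_{2m-k}({1,q}^{k-m+1}) u_n^m satisfy the recurrence
   with exactly this characteristic polynomial, so Binet's formula evaluates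
   them as (t_n^{k+1} - t_{n-1}^{k+1}) / (t_n - t_{n-1}).  The matrices c, g, d
   are combinations of shifts of h, so their row sums are explicit too.
   Summing over n telescopes: each of the four matrices expresses the functions
   n |-> t_n^k (times a factor independent of k) through the normalised sums S
   or T.  The defining identities of P, Q, G, H say the converse, and the t_n
   are pairwise distinct, so the coefficients can be compared.  For c and d this
   happens at s = q^(1/2) in place of q, and the result is transported along
   the substitution s |-> s^2. *)

From HB Require Import structures.
Require Import Defs.
From mathcomp Require Import all_boot all_order all_algebra fraction.
From mathcomp Require Import ring zify.
Set Implicit Arguments. Unset Strict Implicit. Unset Printing Implicit Defensive.
Import GRing.Theory.
Local Open Scope ring_scope.

(** * Recurrences for the complete homogeneous polynomials *)

Lemma coefM_trunc (R : comNzRingType) (p p' r r' : {poly R}) n :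
  (forall i, (i <= n)%N -> p`_i = p'`_i) ->
  (forall i, (i <= n)%N -> r`_i = r'`_i) ->
  forall i, (i <= n)%N -> (p * r)`_i = (p' * r')`_i.
Proof.
move=> hp hr i hi; rewrite !coefM; apply: eq_bigr => j _.
by rewrite hp ?hr //; [lia | have := ltn_ord j; lia].
Qed.

Lemma coefX_trunc (R : comNzRingType) (p p' : {poly R}) n r :
  (forall i, (i <= n)%N -> p`_i = p'`_i) ->
  forall i, (i <= n)%N -> (p ^+ r)`_i = (p' ^+ r)`_i.
Proof.
move=> hp; elim: r => [|r IH] i hi; first by rewrite !expr0.
by rewrite !exprS; apply: (coefM_trunc hp IH).
Qed.

Definition geom (R : comNzRingType) (x : R) N : {poly R} :=
  \sum_(j < N) (x ^+ j) *: 'X^j.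

Lemma coef_geom (R : comNzRingType) (x : R) N i :
  (geom x N)`_i = if (i < N)%N then x ^+ i else 0.
Proof. by rewrite /geom -(poly_def N (fun j => x ^+ j)) coef_poly. Qed.

Lemma geomM (R : comNzRingType) (x : R) N :
  (1 - x *: 'X) * geom x N = 1 - x ^+ N *: 'X^N.
Proof.
elim: N => [|N IH]; first by rewrite /geom big_ord0 mulr0 !expr0 scale1r subrr.
rewrite /geom big_ord_recr /= mulrDr IH !exprS -!mul_polyC !rmorphM /=; ring.
Qed.

(** The truncation order inside [hnat] depends on [n]. Passing to a common order [N] lets values at
    different degrees be read off the same polynomials. *)
Lemma hnatE (R : comNzRingType) (x : R) n N r s : (n < N)%N ->
  hnat n r s x = (geom 1 N ^+ r * geom x N ^+ s)`_n.
Proof.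
move=> hN; rewrite /hnat.
apply: (@coefM_trunc _ _ _ _ _ n) => // i hi; apply: coefX_trunc hi => j hj.
  rewrite coef_geom -[\sum_(_ < _) _](_ : geom 1 n.+1 = _).
    by rewrite coef_geom !(leq_ltn_trans hj).
  by apply: eq_bigr => k _; rewrite expr1n scale1r.
by rewrite -[\sum_(_ < _) _]/(geom x n.+1) !coef_geom !(leq_ltn_trans hj).
Qed.

(** Multiplying the generating function by 1 - z removes one factor. The truncation error starts at
    degree n + 2, above the coefficient compared. *)
Lemma hnatS (R : comNzRingType) (x : R) n r s :
  hnat n.+1 r.+1 s x = hnat n r.+1 s x + hnat n.+1 r s x.
Proof.
rewrite !(@hnatE _ _ _ n.+2) //.
have := geomM (1 : R) n.+2; rewrite scale1r expr1n scale1r => E.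
set p := geom 1 _ in E *; set p' := _ ^+ s.
rewrite [in RHS]addrC; apply/eqP; rewrite -subr_eq; apply/eqP.
have {E}: (1 - 'X) * (p ^+ r.+1 * p') = (1 - 'X^(n.+2)) * (p ^+ r * p').
  by rewrite exprS !mulrA E.
move/(congr1 (fun t : {poly R} => t`_n.+1)).
by rewrite !mulrBl !mul1r !coefB coefXM coefXnM ltnSn /= subr0.
Qed.

Lemma hnatSr (R : comNzRingType) (x : R) n r s :
  hnat n.+1 r s.+1 x = x * hnat n r s.+1 x + hnat n.+1 r s x.
Proof.
rewrite !(@hnatE _ _ _ n.+2) //.
have E := geomM x n.+2.
set p := geom x _ in E *; set p' := _ ^+ r.
rewrite [in RHS]addrC; apply/eqP; rewrite -subr_eq; apply/eqP.
have {E}: (1 - x *: 'X) * (p' * p ^+ s.+1)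
  = (1 - x ^+ n.+2 *: 'X^(n.+2)) * (p' * p ^+ s).
  by rewrite exprS !mulrA ![_ * p']mulrC -!mulrA (mulrA _ p) E.
move/(congr1 (fun t : {poly R} => t`_n.+1)).
rewrite !mulrBl !mul1r !coefB -!scalerAl !coefZ coefXM coefXnM ltnSn /=.
by rewrite mulr0 subr0.
Qed.

Lemma hnat0 (R : comNzRingType) (x : R) r s : hnat 0 r s x = 1.
Proof.
rewrite (@hnatE _ _ _ 1) // /geom !big_ord1 /= !expr0 !scale1r !expr1n mulr1.
by rewrite coef1.
Qed.

Lemma hh_neg (R : comNzRingType) (x : R) (l r s : int) :
  (l < 0) || (r < 0) || (s < 0) -> hh l r s x = 0.
Proof. by case: l r s => [l|l] [r|r] [s|s] // h; exfalso; lia. Qed.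

Lemma hhS (R : comNzRingType) (x : R) (l : int) (r s : nat) :
  hh l r.+1 s x = hh (l - 1) r.+1 s x + hh l r s x.
Proof.
case: l => [[|l]|l]; last by rewrite !hh_neg ?addr0 //; lia.
  by rewrite (@hh_neg _ _ (0%:Z - 1)) // /hh !hnat0 add0r.
by (have -> : (l.+1%:Z - 1)%R = l%:Z by lia); rewrite /hh hnatS.
Qed.

Lemma hhSr (R : comNzRingType) (x : R) (l : int) (r s : nat) :
  hh l r s.+1 x = x * hh (l - 1) r s.+1 x + hh l r s x.
Proof.
case: l => [[|l]|l]; last by rewrite !hh_neg ?mulr0 ?addr0 //; lia.
  by rewrite (@hh_neg _ _ (0%:Z - 1)) // /hh !hnat0 mulr0 add0r.
by (have -> : (l.+1%:Z - 1)%R = l%:Z by lia); rewrite /hh hnatSr.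
Qed.

(** Multiplying by (1 - z)(1 - xz) removes one pair of factors. In terms of [hhS] and [hhSr], the
    unbalanced value with r ones and r + 1 copies of x is eliminated. *)
Lemma hh2S (R : comNzRingType) (x : R) (l : int) (r : nat) :
  hh2 l r.+1 x = (1 + x) * hh2 (l - 1) r.+1 x - x * hh2 (l - 2) r.+1 x + hh2 l r x.
Proof.
rewrite /hh2 [LHS]hhS (hhSr _ _ r r).
have := hhS x (l - 1) r r.+1; have -> : l - 1 - 1 = l - 2 by lia.
move/eqP; rewrite addrC -subr_eq => /eqP <-; ring.
Qed.

(** The indices are integers so that the columns m - 1 and m - 2 of the recurrence make sense for
    small m; such entries are zero. *)
Definition hentry (R : comNzRingType) (x : R) (k m : int) : R :=
  hh2 (2 * m - k) (k - m + 1) x.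

Lemma hentry_eq0 (R : comNzRingType) (x : R) (k m : int) :
  (0 <= k) -> (2 * m < k) || (k < m) -> hentry x k m = 0.
Proof.
move=> k0 h; rewrite /hentry /hh2.
(* At m = k + 1 the number of variables is 0 rather than negative. The entry is then the coefficient
   of degree k + 2 > 0 in the constant 1. *)
case: (eqVneq m (k + 1)) => [->|hm]; last by rewrite hh_neg //; lia.
have -> : k - (k + 1) + 1 = 0 :> int by lia.
have -> : 2 * (k + 1) - k = (absz k).+2 :> int by lia.
by rewrite /hh /hnat !expr0 mulr1 coef1.
Qed.

Lemma hentry_rec (R : comNzRingType) (x : R) (k m : nat) : (m <= k.+2)%N ->
  hentry x k.+2 m = (1 + x) * hentry x k.+1 (m%:Z - 1) - x * hentry x k (m%:Z - 2)
                  + hentry x k (m%:Z - 1).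
Proof.
move=> hm; rewrite /hentry.
have -> : k.+2%:Z - m%:Z + 1 = (k.+2 - m).+1 :> int by lia.
have -> : k.+1%:Z - (m%:Z - 1) + 1 = (k.+2 - m).+1 :> int by lia.
have -> : k%:Z - (m%:Z - 2) + 1 = (k.+2 - m).+1 :> int by lia.
have -> : k%:Z - (m%:Z - 1) + 1 = (k.+2 - m)%N :> int by lia.
rewrite hh2S; congr (_ * hh2 _ _ _ - _ * hh2 _ _ _ + hh2 _ _ _); lia.
Qed.

Definition hrow (R : comNzRingType) (x u : R) (k : nat) : R :=
  \sum_(0 <= m < k.+1) hentry x k m * u ^+ m.

Lemma hrow_trunc (R : comNzRingType) (x u : R) (k N : nat) : (k < N)%N ->
  \sum_(0 <= m < N) hentry x k m * u ^+ m = hrow x u k.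
Proof.
move=> hN; rewrite (@big_cat_nat _ _ _ k.+1) //= -[RHS]addr0; congr (_ + _).
rewrite big_nat_cond big1 // => i /andP[/andP[hi _] _].
by rewrite hentry_eq0 ?mul0r //; lia.
Qed.

Lemma hrow_shift (R : comNzRingType) (x u : R) (k N : nat) : (k < N)%N ->
  \sum_(0 <= m < N.+1) hentry x k (m%:Z - 1) * u ^+ m = u * hrow x u k.
Proof.
move=> hN; rewrite big_nat_recl // hentry_eq0; [|lia|lia]; rewrite mul0r add0r.
rewrite -(hrow_trunc _ _ hN) mulr_sumr; apply: eq_bigr => i _.
by rewrite exprS; (have -> : i.+1%:Z - 1 = i%:Z by lia); ring.
Qed.

(** In [hentry_rec] every shift of the column by one contributes a factor u to the row sum. *)
Lemma hrow_rec (R : comNzRingType) (x u : R) (k : nat) :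
  hrow x u k.+2 = (1 + x) * u * hrow x u k.+1 - (x * u ^+ 2 - u) * hrow x u k.
Proof.
have -> : hrow x u k.+2 = \sum_(0 <= m < k.+3)
   ((1 + x) * (hentry x k.+1 (m%:Z - 1) * u ^+ m)
    - x * (hentry x k (m%:Z - 2) * u ^+ m) + hentry x k (m%:Z - 1) * u ^+ m).
  rewrite /hrow !big_nat; apply: eq_bigr => i /andP[_ hi].
  by rewrite hentry_rec //; ring.
rewrite big_split sumrB -!mulr_sumr !hrow_shift //=.
rewrite big_nat_recl // hentry_eq0; [|lia|lia]; rewrite mul0r add0r.
have -> : \sum_(0 <= i < k.+2) hentry x k (i.+1%:Z - 2) * u ^+ i.+1
   = u * \sum_(0 <= i < k.+2) hentry x k (i%:Z - 1) * u ^+ i.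
  rewrite mulr_sumr; apply: eq_bigr => i _.
  by rewrite exprS; (have -> : i.+1%:Z - 2 = i%:Z - 1 by lia); ring.
rewrite hrow_shift //; ring.
Qed.

Lemma hrow0 (R : comNzRingType) (x u : R) : hrow x u 0 = 1.
Proof. by rewrite /hrow big_nat1 expr0 mulr1 /hentry /hh2 /= hnat0. Qed.

Lemma hrow1 (R : comNzRingType) (x u : R) : hrow x u 1 = (1 + x) * u.
Proof.
rewrite /hrow !big_nat_recr //= big_nil add0r hentry_eq0 // mul0r add0r expr1.
congr (_ * _); rewrite /hentry /hh2 /= -[hnat _ _ _ _]/(hh2 1%:Z 1%N x) hh2S.
rewrite /hh2 /= !hnat0 /hnat !expr0 mul1r coef1 /=; ring.
Qed.

(** a and b are the roots of the characteristic polynomial of [hrow_rec]. The factor a - b stays on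
    the left, so the formula holds over any commutative ring. *)
Lemma hrow_binet (R : comNzRingType) (x u a b : R) :
  a + b = (1 + x) * u -> a * b = x * u ^+ 2 - u ->
  forall k, (a - b) * hrow x u k = a ^+ k.+1 - b ^+ k.+1.
Proof.
move=> hs hp k.
have [] : (a - b) * hrow x u k = a ^+ k.+1 - b ^+ k.+1
   /\ (a - b) * hrow x u k.+1 = a ^+ k.+2 - b ^+ k.+2; last by [].
elim: k => [|k [IH1 IH2]].
  by rewrite hrow0 hrow1 -hs; split; ring.
split=> //; rewrite hrow_rec -hs -hp.
have -> : (a - b) * ((a + b) * hrow x u k.+1 - a * b * hrow x u k) =
 (a + b) * ((a - b) * hrow x u k.+1) - a * b * ((a - b) * hrow x u k) by ring.
rewrite IH1 IH2 !exprS; ring.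
Qed.

(** * The nodes t_n *)

Definition not_root1 (K : fieldType) (s : K) : Prop :=
  s != 0 /\ forall k, (0 < k)%N -> 1 - s ^+ k != 0.

Definition qnum (K : fieldType) (s : K) (n : nat) : K :=
  (1 - (s ^+ 2) ^+ n) / (1 - s ^+ 2).
Definition tq (K : fieldType) (s : K) (n : nat) : K :=
  qnum s n * qnum s n.+1 / (s ^+ 2) ^+ n.
Definition uq (K : fieldType) (s : K) (n : nat) : K :=
  qnum s n ^+ 2 / (s ^+ 2) ^+ n.
(** The prefactor 1 - q^(n+1/2) of the identities for Q and H, normalised by q^(n/2). *)
Definition rho (K : fieldType) (s : K) (n : nat) : K :=
  (1 - s ^+ (2 * n + 1)) / s ^+ n.

Lemma qnum_neq0 (K : fieldType) (s : K) : not_root1 s ->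
  forall n, (0 < n)%N -> qnum s n != 0.
Proof.
move=> [s0 hs] n n0; rewrite /qnum mulf_neq0 ?invr_eq0 ?hs //.
by rewrite -exprM hs //; lia.
Qed.

(* Every identity is one of rational functions in s and y = s^n. *)
Local Ltac tq_field s :=
  let s0 := fresh in let hs := fresh in let s1 := fresh in let q1 := fresh in
  let n := fresh in let y := fresh in let y0 := fresh in
  move=> [s0 hs] n; have := hs 2 isT; rewrite expr2 => q1;
  have := hs 1 isT; rewrite expr1 => s1;
  rewrite /tq /uq /rho /qnum ?addn1 ?[(2 * _)%N]mulnC ?(exprM (s ^+ 2))
    ?(exprS s (_ * 2)) ?(exprM s) -?(exprAC n) !exprS !expr0 !mulr1 -?expr2 ?exprMn;
  have y0 := expf_neq0 n s0; move: (s ^+ n) y0 => y y0;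
  by field; rewrite ?s1 ?q1 ?s0 y0.

Lemma tq_add (K : fieldType) (s : K) : not_root1 s -> forall n,
  tq s n.+1 + tq s n = (1 + s ^+ 2) * uq s n.+1.
Proof. tq_field s. Qed.

Lemma tq_mul (K : fieldType) (s : K) : not_root1 s -> forall n,
  tq s n.+1 * tq s n = s ^+ 2 * uq s n.+1 ^+ 2 - uq s n.+1.
Proof. tq_field s. Qed.

Lemma tq_sub (K : fieldType) (s : K) : not_root1 s -> forall n,
  tq s n.+1 - tq s n = qnum s (2 * n.+1) / (s ^+ 2) ^+ n.+1.
Proof. tq_field s. Qed.

(** The row sums of c and d contain the factors t + s u. This identity and the next split off the
    same factor from both of them, leaving [rho] at consecutive indices, so that those sums
    telescope as well. *)
Lemma tq_rho (K : fieldType) (s : K) : not_root1 s -> forall n,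
  tq s n.+1 + s * uq s n.+1 = qnum s n.+1 / s ^+ n.+1 * rho s n.+1 / (1 - s).
Proof. tq_field s. Qed.

Lemma tq_rho_pred (K : fieldType) (s : K) : not_root1 s -> forall n,
  tq s n + s * uq s n.+1 = qnum s n.+1 / s ^+ n.+1 * rho s n / (1 - s).
Proof. tq_field s. Qed.

Lemma rho_sqr (K : fieldType) (s : K) : not_root1 s -> forall n,
  rho s n ^+ 2 = (1 - s ^+ 2) ^+ 2 * tq s n + (1 - s) ^+ 2.
Proof. tq_field s. Qed.

Lemma tq_sub_neq0 (K : fieldType) (s : K) : not_root1 s -> forall n,
  tq s n.+1 - tq s n != 0.
Proof.
move=> hs n; rewrite tq_sub // mulf_neq0 ?qnum_neq0 //.
by case: hs => s0 _; rewrite invr_eq0 !expf_neq0.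
Qed.

Lemma not_root1_inj (K : fieldType) (s : K) : not_root1 s ->
  injective (fun k : nat => s ^+ k).
Proof.
move=> [s0 hs] i j; wlog ij : i j / (i <= j)%N => [W|] E.
  by case/orP: (leq_total i j) => h; [|apply/esym]; exact: W.
apply/eqP; rewrite eqn_leq ij leqNgt /=; apply/negP => ltij.
have /hs/negP[] : (0 < j - i)%N by rewrite subn_gt0.
apply/eqP; apply: (mulfI (expf_neq0 i s0)).
by rewrite mulr0 mulrBr mulr1 -exprD subnKC // E subrr.
Qed.

(** With q = s^2, the numerator of t_n - t_m factors as (q^m - q^n)(1 - q^(n+m+1)), and the second
    factor never vanishes. *)
Lemma tq_inj (K : fieldType) (s : K) : not_root1 s -> injective (tq s).
Proof.
move=> hs n m /eqP; case: (hs) => s0 h1; rewrite -subr_eq0.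
have q1 := h1 2 isT.
have yn : (s ^+ 2) ^+ n != 0 by rewrite !expf_neq0.
have ym : (s ^+ 2) ^+ m != 0 by rewrite !expf_neq0.
have -> : tq s n - tq s m
   = ((s ^+ 2) ^+ m - (s ^+ 2) ^+ n) * (1 - (s ^+ 2) ^+ (n + m).+1)
     / ((s ^+ 2) ^+ n * (s ^+ 2) ^+ m * (1 - s ^+ 2) ^+ 2).
  rewrite /tq /qnum !(exprS (s ^+ 2)) exprD.
  move: ((s ^+ 2) ^+ n) ((s ^+ 2) ^+ m) yn ym => a b yn ym; field.
  by rewrite q1 yn ym.
have q2 : 1 - (s ^+ 2) ^+ (n + m).+1 != 0 by rewrite -exprM h1 //; lia.
rewrite !mulf_eq0 invr_eq0 !mulf_eq0 (negPf q1) (negPf yn) (negPf ym).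
rewrite (negPf q2) !orbF subr_eq0 -!exprM => /eqP /(not_root1_inj hs); lia.
Qed.

Lemma poly_tq_eq0 (K : fieldType) (s : K) (p : {poly K}) : not_root1 s ->
  (forall n, (0 < n)%N -> p.[tq s n] = 0) -> p = 0.
Proof.
move=> hs hp; apply: (@roots_geq_poly_eq0 _ p [seq tq s i | i <- iota 1 (size p)]).
- by apply/allP => x /mapP[i]; rewrite mem_iota => /andP[hi _] ->; rewrite rootE hp.
- by rewrite map_inj_uniq ?iota_uniq //; exact: tq_inj hs.
- by rewrite size_map size_iota.
Qed.

(** The constant [c] makes room for the k = 0 term of the identity for Q, to which no matrix column
    corresponds. *)
Lemma tq_indep (K : fieldType) (s : K) (n : nat) (e : 'I_n -> K)
    (c : K) : not_root1 s ->
  (forall N, (0 < N)%N -> c + \sum_l e l * tq s N ^+ l.+1 = 0) -> forall l, e l = 0.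
Proof.
move=> hs h l.
pose p : {poly K} := c%:P + \sum_l e l *: 'X^(l.+1).
have : p = 0.
  apply: (poly_tq_eq0 hs) => N hN; rewrite -[RHS](h N hN) hornerD hornerC horner_sum.
  by congr (_ + _); apply: eq_bigr => i _; rewrite hornerZ hornerXn.
move/(congr1 (fun p : {poly K} => p`_l.+1)).
rewrite coefD coefC add0r coef_sum coef0 (bigD1 l) //= big1 ?addr0.
  by rewrite coefZ coefXn eqxx mulr1.
by move=> i hi; rewrite coefZ coefXn eqSS (inj_eq val_inj) eq_sym (negPf hi) mulr0.
Qed.

(* Squaring removes the sign [(-1) ^+ N]; since [rho s N ^+ 2] is affine in
   [tq s N], a nontrivial relation would make a polynomial of odd degree constant. *)
Lemma rho_tq_indep (K : fieldType) (s : K) (n : nat) (e : 'I_n -> K)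
    (c : K) : not_root1 s ->
  (forall N, (0 < N)%N -> \sum_l e l * ((-1) ^+ N * rho s N * tq s N ^+ l) = c) ->
  forall l, e l = 0.
Proof.
move=> hs h l.
pose p : {poly K} := \sum_l e l *: 'X^l.
pose r : {poly K} := ((1 - s ^+ 2) ^+ 2) *: 'X + ((1 - s) ^+ 2)%:P.
have q1 : (1 - s ^+ 2) ^+ 2 != 0 by rewrite expf_neq0 //; exact: (hs.2 2).
have pE N : p.[tq s N] = \sum_l e l * tq s N ^+ l.
  by rewrite horner_sum; apply: eq_bigr => i _; rewrite hornerZ hornerXn.
have E : p ^+ 2 * r - (c ^+ 2)%:P = 0.
  apply: (poly_tq_eq0 hs) => N hN; apply/eqP; rewrite hornerD hornerN hornerC subr_eq0.
  rewrite hornerM horner_exp /r hornerD hornerC hornerZ hornerX -(rho_sqr hs) pE.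
  rewrite -(h N hN).
  under [in X in _ == X]eq_bigr => i _ do rewrite mulrCA.
  by rewrite -mulr_sumr !exprMn sqrr_sign mul1r mulrC.
have sr : size r = 2.
  by rewrite /r -mul_polyC size_MXaddC polyC_eq0 (negPf q1) size_polyC q1.
have p0 : p = 0.
  apply/eqP; apply: contraT => p0.
  have r0 : r != 0 by rewrite -size_poly_eq0 sr.
  have p20 : p ^+ 2 != 0 by rewrite expf_neq0.
  move/eqP: E; rewrite subr_eq0 => /eqP /(congr1 (fun p : {poly K} => size p)).
  rewrite size_mul // sr addn2 /= => E; have := size_polyC_leq1 (c ^+ 2).
  by rewrite -E ltnS leqn0 size_poly_eq0 (negPf p20).
move/(congr1 (fun p : {poly K} => p`_l)): p0.
rewrite coef_sum coef0 (bigD1 l) //= big1 ?addr0.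
  by rewrite coefZ coefXn eqxx mulr1.
by move=> i hi; rewrite coefZ coefXn (inj_eq val_inj) eq_sym (negPf hi) mulr0.
Qed.

Lemma sq_not_root1 : not_root1 sq.
Proof.
split=> [|k k0]; first by rewrite /sq tofrac_eq0 polyX_eq0.
rewrite subr_eq0 eq_sym /sq -tofracXn -tofrac1 tofrac_eq; apply/eqP.
by move/(congr1 (fun p : {poly int} => size p)); rewrite size_polyXn size_poly1; lia.
Qed.

(** * Substitution in the fraction field *)

Lemma frac_repr (R : idomainType) (x : {fraction R}) :
  exists n d : R, d != 0 /\ x = tofrac n / tofrac d.
Proof.
elim/quotW: x => y; exists \n_y, \d_y; split; first exact: denom_ratioP.
have d0 : tofrac \d_y != 0 by rewrite tofrac_eq0 denom_ratioP.
apply: (mulIf d0); rewrite divfK //.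
(* With the denominator cleared, both sides are classes of ratios and are compared by cross
   multiplication. *)
rewrite !piE /FracField.mulf /=; apply/eqP; rewrite piE /FracField.equivf /=.
by rewrite !numden_Ratio ?mulr1 ?oner_neq0 ?denom_ratioP // mulrC.
Qed.

(** Universal property of the fraction field: injectivity of f keeps the images of denominators
    nonzero. *)
Lemma frac_lift (R : idomainType) (K : fieldType) (f : {rmorphism R -> K}) :
  injective f ->
  exists phi : {rmorphism {fraction R} -> K}, forall x, phi (tofrac x) = f x.
Proof.
move=> f_inj.
have fneq0 d : d != 0 -> f d != 0 by rewrite -(inj_eq f_inj) rmorph0.
have ex (x : {fraction R}) : 
  exists nd : R * R, (nd.2 != 0) && (x == tofrac nd.1 / tofrac nd.2).
  by have [n [d [d0 E]]] := frac_repr x; exists (n, d); rewrite d0 E /=.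
pose phi x := let nd := xchoose (ex x) in f nd.1 / f nd.2.
(* [phi] is defined through a chosen representative; this shows that the choice does not matter. *)
have phiE n d : d != 0 -> phi (tofrac n / tofrac d) = f n / f d.
  move=> d0; rewrite /phi; move: (xchoose _) (xchooseP (ex (tofrac n / tofrac d))).
  move=> [n' d'] /= /andP[d'0 /eqP].
  move/eqP; rewrite eqr_div ?tofrac_eq0 // -!tofracM tofrac_eq => /eqP E.
  by apply/eqP; rewrite eqr_div ?fneq0 // -!rmorphM /= E.
have tf0 (d : R) : d != 0 -> tofrac d != 0 by rewrite tofrac_eq0.
have phiB : zmod_morphism phi.
  move=> x y; have [n [d [d0 ->]]] := frac_repr x.
  have [n' [d' [d'0 ->]]] := frac_repr y.
  rewrite -mulNr addf_div ?tf0 // -tofracN -!tofracM -tofracD.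
  rewrite !phiE ?mulf_neq0 // -[X in _ = _ + X]mulNr addf_div ?fneq0 //.
  by rewrite rmorphD !rmorphM rmorphN.
have phiM : monoid_morphism phi.
  split=> [|x y].
    by rewrite -[1]divr1 -tofrac1 phiE ?oner_neq0 // rmorph1 divr1.
  have [n [d [d0 ->]]] := frac_repr x.
  have [n' [d' [d'0 ->]]] := frac_repr y.
  by rewrite mulf_div -!tofracM !phiE ?mulf_neq0 // !rmorphM mulf_div.
pose phia := GRing.isZmodMorphism.Build _ _ phi phiB.
pose phim := GRing.isMonoidMorphism.Build _ _ phi phiM.
pose phir : {rmorphism {fraction R} -> K} := HB.pack phi phia phim.
exists phir => x; rewrite /phir /=.
by rewrite -[tofrac x]divr1 -tofrac1 phiE ?oner_neq0 // rmorph1 divr1.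
Qed.

(** Composition with X^2 is injective on polynomials, hence extends to fractions. *)
Lemma sq_substitution : exists phi : {rmorphism F -> F}, phi sq = qq.
Proof.
pose f (p : {poly int}) : F := tofrac (p \Po 'X^2).
have fB : zmod_morphism f by move=> p r; rewrite /f !rmorphB.
have fM : monoid_morphism f by split=> [|p r]; rewrite /f ?rmorph1 ?rmorphM.
pose fa := GRing.isZmodMorphism.Build _ _ f fB.
pose fm := GRing.isMonoidMorphism.Build _ _ f fM.
pose g : {rmorphism {poly int} -> F} := HB.pack f fa fm.
have [|phi phiE] := @frac_lift _ _ g.
  apply: raddf_inj => p /eqP; rewrite /= /f tofrac_eq0 comp_poly_eq0 => [/eqP //|].
  by rewrite size_polyXn.
by exists phi; rewrite [LHS]phiE /= /f comp_polyX tofracXn.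
Qed.

Lemma rmorph_ev (phi : {rmorphism F -> F}) p x : phi (ev p x) = ev p (phi x).
Proof.
rewrite /ev -horner_map /= -map_poly_comp; congr (_.[_]).
by apply: eq_map_poly => z /=; rewrite rmorph_int.
Qed.

Lemma rmorph_hh (phi : {rmorphism F -> F}) l r s x :
  phi (hh l r s x) = hh l r s (phi x).
Proof.
case: l r s => [l|l] [r|r] [s|s]; rewrite /hh ?rmorph0 //.
rewrite /hnat -coef_map rmorphM !rmorphXn !rmorph_sum /=.
congr (nth 0 (polyseq (_ ^+ _ * _ ^+ _)) _); apply: eq_bigr => i _.
  by rewrite map_polyXn.
by rewrite map_polyZ map_polyXn rmorphXn.
Qed.

Lemma rmorph_cc (phi : {rmorphism F -> F}) x k m : phi (cc x k m) = cc (phi x) k m.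
Proof. by rewrite /cc rmorphD rmorphM /= !rmorph_hh rmorphXn. Qed.

Lemma rmorph_dd (phi : {rmorphism F -> F}) x k m : phi (dd x k m) = dd (phi x) k m.
Proof. by rewrite /dd /gg !(rmorphD, rmorphM) /= !rmorph_hh rmorphXn. Qed.

(** * Row sums of the matrices *)

(** Removing a factor 1 - z, respectively 1 - xz, from the balanced product yields the two summands
    of g; the two recurrences are added. *)
Lemma gg_hentry (x : F) (k m : nat) :
  gg x k.+1 m = 2 * hentry x k.+1 m - (1 + x) * hentry x k (m%:Z - 1).
Proof.
rewrite /gg; have [hm|hm] := leqP m k.+1; last first.
  rewrite !hh_neg; [|lia|lia].
  by rewrite !hentry_eq0; [ring|lia|lia|lia|lia].
rewrite /hentry.
have -> : k.+1%:Z - m%:Z + 1 = (k.+1 - m).+1 :> int by lia.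
have -> : k%:Z - (m%:Z - 1) + 1 = (k.+1 - m).+1 :> int by lia.
have -> : k.+1%:Z - m%:Z = (k.+1 - m)%N :> int by lia.
have -> : 2 * (m%:Z - 1) - k%:Z = (2 * m%:Z - k.+1%:Z) - 1 :> int by lia.
move: (2 * m%:Z - k.+1%:Z) (k.+1 - m)%N => l r.
have := hhS x l r r.+1; have := hhSr x l r.+1 r; rewrite /hh2.
set h := hh l r.+1 r.+1 x => E1 E2.
have -> : 2 * h = h + h by ring.
rewrite {1}E1 E2; ring.
Qed.

Lemma gg_neg x (k m : int) : 2 * m < k -> gg x k m = 0.
Proof. by move=> h; rewrite /gg !hh_neg ?addr0 //; lia. Qed.

(** By Binet's formula the claim reduces to 2(a^(k+1) - b^(k+1)) - (a + b)(a^k - b^k) = (a - b)(a^k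
    + b^k): g is to h what Lucas numbers are to Fibonacci numbers. *)
Lemma sum_gg (x u a b : F) (k N : nat) :
  a + b = (1 + x) * u -> a * b = x * u ^+ 2 - u -> a - b != 0 -> (k < N)%N ->
  \sum_(0 <= m < N) gg x k m * u ^+ m = a ^+ k + b ^+ k.
Proof.
move=> hs hp hab; case: k N => [|k] [//|N] hN.
  rewrite big_nat_recl // big1 => [|i _].
    by rewrite /gg /hh /= !hnat0 !expr0; ring.
  rewrite /gg !hh_neg; [by rewrite addr0 mul0r|lia|lia].
have -> : \sum_(0 <= m < N.+1) gg x k.+1 m * u ^+ m
  = 2 * hrow x u k.+1 - (1 + x) * (u * hrow x u k).
  rewrite -(hrow_trunc _ _ hN) -(@hrow_shift _ _ _ _ N) // !mulr_sumr -sumrB.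
  by apply: eq_bigr => i _; rewrite gg_hentry; ring.
apply: (mulfI hab).
have -> : (a - b) * (2 * hrow x u k.+1 - (1 + x) * (u * hrow x u k))
  = 2 * ((a - b) * hrow x u k.+1) - ((1 + x) * u) * ((a - b) * hrow x u k) by ring.
rewrite !(hrow_binet hs hp) -hs !exprS; ring.
Qed.

Lemma sum_dd (s u a b : F) (k N : nat) :
  a + b = (1 + s ^+ 2) * u -> a * b = s ^+ 2 * u ^+ 2 - u -> a - b != 0 ->
  (k.+1 < N)%N ->
  \sum_(0 <= m < N) dd s k.+1 m * u ^+ m
  = a ^+ k * (a + s * u) + b ^+ k * (b + s * u).
Proof.
move=> hs hp hab; case: N => // N hN.
have -> : \sum_(0 <= m < N.+1) dd s k.+1 m * u ^+ m
  = \sum_(0 <= m < N.+1) gg (s ^+ 2) k.+1 m * u ^+ m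
    + s * u * \sum_(0 <= m < N) gg (s ^+ 2) k m * u ^+ m.
  rewrite /dd; under eq_bigr => i _ do rewrite mulrDl.
  rewrite big_split; congr (_ + _) => /=.
  rewrite big_nat_recl // (@gg_neg _ _ (_ - 1)); last by lia.
  rewrite mulr0 mul0r add0r mulr_sumr; apply: eq_bigr => i _.
  rewrite (exprS u i); have -> : i.+1%:Z - 1 = i%:Z by lia.
  have -> : k.+1%:Z - 1 = k%:Z by lia.
  ring.
rewrite !(sum_gg hs hp hab) // !exprS; ring.
Qed.

(** c_{k,m} is the entry of h at (k, m) plus s times the entry at (k - 1, m - 1), and the diagonal
    shift contributes a factor u. *)
Lemma sum_cc (s u a b : F) (k N : nat) :
  a + b = (1 + s ^+ 2) * u -> a * b = s ^+ 2 * u ^+ 2 - u -> (k.+1 < N)%N ->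
  (a - b) * (\sum_(0 <= m < N) cc s k.+1 m * u ^+ m)
  = a ^+ k.+1 * (a + s * u) - b ^+ k.+1 * (b + s * u).
Proof.
move=> hs hp; case: N => // N hN.
have -> : \sum_(0 <= m < N.+1) cc s k.+1 m * u ^+ m
  = hrow (s ^+ 2) u k.+1 + s * (u * hrow (s ^+ 2) u k).
  rewrite -(hrow_trunc _ _ hN) -(@hrow_shift _ _ _ _ N) // !mulr_sumr -big_split.
  apply: eq_bigr => i _; rewrite /cc /= /hentry.
  have -> : 2 * (i%:Z - 1) - k%:Z = 2 * i%:Z - k.+1%:Z - 1 by lia.
  have -> : k%:Z - (i%:Z - 1) + 1 = k.+1%:Z - i%:Z + 1 by lia.
  ring.
have -> : (a - b) * (hrow (s ^+ 2) u k.+1 + s * (u * hrow (s ^+ 2) u k)) =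
  (a - b) * hrow (s ^+ 2) u k.+1 + s * u * ((a - b) * hrow (s ^+ 2) u k) by ring.
rewrite !(hrow_binet hs hp) !exprS; ring.
Qed.

(** * Comparison of coefficients *)

(** M fixes the vectors of powers of t_N up to a constant vector, and these powers are linearly
    independent as functions of N. *)
Lemma mx_eq1_tq (K : fieldType) (s : K) (n : nat) (M : 'M[K]_n) (c : 'I_n -> K) :
  not_root1 s ->
  (forall N i, (0 < N)%N ->
     c i + \sum_l M i l * tq s N ^+ l.+1 = tq s N ^+ i.+1) ->
  M = 1%:M.
Proof.
move=> hs h; apply/matrixP => i l; apply/eqP; rewrite -subr_eq0; apply/eqP.
apply: (tq_indep (e := fun l => M i l - 1%:M i l) (c := c i) hs) => N hN.
under eq_bigr => j _ do rewrite mulrBl.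
rewrite sumrB addrA h // (bigD1 i) //= big1 ?addr0.
  by rewrite mxE eqxx mul1r subrr.
by move=> j hj; rewrite mxE eq_sym (negPf hj) mul0r.
Qed.

Lemma mx_eq1_rho (K : fieldType) (s : K) (n : nat) (M : 'M[K]_n) (c : 'I_n -> K) :
  not_root1 s ->
  (forall N i, (0 < N)%N ->
     \sum_l M i l * ((-1) ^+ N * rho s N * tq s N ^+ l)
     = (-1) ^+ N * rho s N * tq s N ^+ i + c i) ->
  M = 1%:M.
Proof.
move=> hs h; apply/matrixP => i l; apply/eqP; rewrite -subr_eq0; apply/eqP.
apply: (rho_tq_indep (e := fun l => M i l - 1%:M i l) (c := c i) hs) => N hN.
under eq_bigr => j _ do rewrite mulrBl.
rewrite sumrB h // [X in _ - X](bigD1 i) //= [X in _ - (_ + X)]big1 ?addr0.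
  by rewrite mxE eqxx mul1r addrAC subrr add0r.
by move=> j hj; rewrite mxE eq_sym (negPf hj) mul0r.
Qed.

Lemma sum_mulmx (R : comNzRingType) (n : nat) (A B : 'M[R]_n) (v : 'I_n -> R) i :
  \sum_l (A *m B) i l * v l = \sum_j A i j * \sum_l B j l * v l.
Proof.
under eq_bigr => l _ do rewrite mxE mulr_suml.
rewrite exchange_big; apply: eq_bigr => j _; rewrite mulr_sumr.
by apply: eq_bigr => l _; rewrite mulrA.
Qed.

Lemma sum_telescope (R : comNzRingType) (n : nat) (A : 'I_n -> R)
    (f : 'I_n -> nat -> R) (Phi : nat -> R) :
  (forall l, \sum_j A j * f j l.+1 = Phi l.+1 - Phi l) ->
  forall N, \sum_j A j * (\sum_(1 <= l < N.+1) f j l) = Phi N - Phi 0%N.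
Proof.
move=> h N; under eq_bigr => j _ do rewrite mulr_sumr.
rewrite exchange_big big_add1 /= -telescope_sumr //.
by apply: eq_bigr => l _; rewrite h.
Qed.

(** Turns the sums in the defining identities into full row sums of lower triangular matrices. *)
Lemma big_ord_if (R : comNzRingType) (n m : nat) (E : nat -> R) : (m < n)%N ->
  \sum_(0 <= k < m.+1) E k = \sum_(l < n) if (l <= m)%N then E l else 0.
Proof. by move=> h; rewrite big_mkord (big_ord_widen n E) // big_mkcond. Qed.

Lemma big_ord_shift (R : comNzRingType) (n : nat) (E : nat -> R) : E 0%N = 0 ->
  \sum_(j < n) E j.+1 = \sum_(0 <= m < n.+1) E m.
Proof. by move=> E0; rewrite big_nat_recl // E0 add0r big_mkord. Qed.

(** * Normalised sums *)

Lemma mulfK_div (K : fieldType) (x y z : K) : y != 0 -> x * y / (y * z) = x / z.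
Proof. by move=> y0; rewrite invfM mulrA mulfK. Qed.

(** The division makes the summand independent of N, which telescoping requires. [Tsum_div] does the
    same, with the sign included. *)
Lemma Ssum_div (m N : nat) :
  Ssum m N / sq ^+ ((m + 1) * N) =
  \sum_(1 <= j < N.+1) qint qq (2 * j) / qint qq 2 * qint qq j ^+ m.-1
     / sq ^+ ((m + 1) * j).
Proof.
rewrite /Ssum mulr_suml !big_nat; apply: eq_bigr => j /andP[_ hj].
have s0 k : sq ^+ k != 0 by rewrite expf_neq0 // sq_not_root1.1.
have -> : ((m + 1) * N = (m + 1) * (N - j) + (m + 1) * j)%N by nia.
by rewrite exprD mulfK_div.
Qed.

Lemma Tsum_div (m N : nat) :
  (-1) ^+ N * (Tsum m N / sq ^+ (m * N)) =
  \sum_(1 <= j < N.+1) (-1) ^+ j * (qint qq j ^+ m / sq ^+ (m * j)).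
Proof.
rewrite /Tsum mulr_suml mulr_sumr !big_nat; apply: eq_bigr => j /andP[_ hj].
have s0 k : sq ^+ k != 0 by rewrite expf_neq0 // sq_not_root1.1.
have -> : (m * N = m * (N - j) + m * j)%N by nia.
have -> : (-1) ^+ N = (-1) ^+ (N - j) * (-1) ^+ j :> F.
  by rewrite -exprD subnK.
rewrite exprD mulfK_div // -[X in _ * X]mulrA mulrACA.
by rewrite -expr2 sqrr_sign mul1r.
Qed.

Lemma qint_neq0 k : (0 < k)%N -> qint qq k != 0.
Proof. exact: (qnum_neq0 sq_not_root1). Qed.

Lemma uqX (K : fieldType) (s : K) l j :
  uq s l ^+ j = qnum s l ^+ (2 * j) / (s ^+ l) ^+ (2 * j).
Proof. by rewrite /uq expr_div_n -!exprM mulnCA mulnA. Qed.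

Lemma ratio_cancel1 (K : fieldType) (a b w x y : K) : b != 0 ->
  b * (a / b * w / (x * y)) = a / x * (w / y).
(* With the inverses opaque, [field] asks for no condition on x and y. *)
Proof. by move=> b0; rewrite invfM; set x' := x^-1; set y' := y^-1; field. Qed.

Lemma ratio_cancel2 (K : fieldType) (a b w w' x y : K) : b != 0 -> w != 0 ->
  b * (a / b * w' / (x * y)) = a / (w * x) * (w * w' / y).
Proof.
by move=> b0 w0; rewrite !invfM; set x' := x^-1; set y' := y^-1; field; rewrite b0 w0.
Qed.

Lemma ratio_cancel3 (K : fieldType) (w w' x y : K) : w != 0 -> x != 0 ->
  w' / y = x / w * (w * w' / (x * y)).
Proof.
by move=> w0 x0; rewrite !invfM; set y' := y^-1; field; rewrite x0 w0.
Qed.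

(** Used with a = q^N: of the powers of -q^N only the sign remains, and the power of [N][N+1]
    becomes a power of t_N. *)
Lemma sign_cancel (K : fieldType) (a X t : K) d k : a != 0 ->
  (- a) ^+ d * X * t / a ^+ (d + k) = (-1) ^+ d * X * (t / a ^+ k).
Proof.
move=> a0; rewrite -(mulN1r a) exprMn exprD.
have ad : a ^+ d != 0 by rewrite expf_neq0.
rewrite invfM; set x' := (a ^+ k)^-1; field; exact: ad.
Qed.

Lemma sqX_neq0 k : sq ^+ k != 0.
Proof. by rewrite expf_neq0 // sq_not_root1.1. Qed.

Lemma qqX_neq0 k : qq ^+ k != 0.
Proof. by rewrite expf_neq0 // sqX_neq0. Qed.

Lemma subr1_sq : 1 - sq != 0.
Proof. exact: (sq_not_root1.2 1%N). Qed.

Lemma rho_neq0 N : rho sq N != 0.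
Proof. by rewrite mulf_neq0 ?invr_eq0 ?sqX_neq0 // sq_not_root1.2 // addn1. Qed.

(* The index j stands for S_{2j+1} in [S_odd], but for S_{2j+2}, T_{2j+2} and
   T_{2j+1} in the other three, matching matrices indexed from 1. *)
Definition S_odd (j N : nat) : F :=
  qint qq 2 * (Ssum (2 * j + 1) N / sq ^+ ((2 * j + 1 + 1) * N)).
Definition S_even (j N : nat) : F :=
  qint qq 2 * (Ssum (2 * j.+1) N / sq ^+ ((2 * j.+1 + 1) * N)).
Definition T_even (j N : nat) : F :=
  (-1) ^+ N * (Tsum (2 * j.+1) N / sq ^+ (2 * j.+1 * N)).
Definition T_odd (j N : nat) : F :=
  (-1) ^+ N * (Tsum (2 * j.+1 - 1) N / sq ^+ ((2 * j.+1 - 1) * N)).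

Lemma S_oddE j N : S_odd j N =
  \sum_(1 <= l < N.+1) qint qq (2 * l) / qq ^+ l * uq sq l ^+ j.
Proof.
rewrite /S_odd Ssum_div mulr_sumr; apply: eq_bigr => l _.
have -> : ((2 * j + 1 + 1) * l = 2 * l + l * (2 * j))%N by lia.
rewrite uqX exprD (exprM sq 2) (exprM sq l) addn1 /= ratio_cancel1 //.
exact: qint_neq0.
Qed.

Lemma S_evenE j N : S_even j N =
  \sum_(1 <= l < N.+1) qint qq (2 * l) / (qint qq l * sq ^+ l) * uq sq l ^+ j.+1.
Proof.
rewrite /S_even Ssum_div mulr_sumr !big_nat; apply: eq_bigr => l /andP[l0 _].
have -> : ((2 * j.+1 + 1) * l = l + l * (2 * j.+1))%N by lia.
rewrite uqX exprD (exprM sq) (@ratio_cancel2 _ _ _ (qint qq l)) ?qint_neq0 //.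
by rewrite -exprS; have -> : (2 * j.+1).-1.+1 = (2 * j.+1)%N by lia.
Qed.

Lemma T_evenE j N : T_even j N = \sum_(1 <= l < N.+1) (-1) ^+ l * uq sq l ^+ j.+1.
Proof.
rewrite /T_even Tsum_div; apply: eq_bigr => l _.
by rewrite uqX -exprM [(l * _)%N]mulnC.
Qed.

Lemma T_oddE j N : T_odd j N =
  \sum_(1 <= l < N.+1) (-1) ^+ l * (sq ^+ l / qint qq l * uq sq l ^+ j.+1).
Proof.
rewrite /T_odd Tsum_div !big_nat; apply: eq_bigr => l /andP[l0 _]; congr (_ * _).
rewrite uqX (@ratio_cancel3 _ (qint qq l) _ (sq ^+ l)) ?qint_neq0 ?sqX_neq0 //.
rewrite -exprS -exprD -exprM; congr (_ * (_ ^+ _ / _ ^+ _)); lia.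
Qed.

(** * Action of the matrices on the summands *)

Lemma Hmx_step (n : nat) (i : 'I_n.+1) l :
  \sum_j Hmx n i j * (qint qq (2 * l.+1) / qq ^+ l.+1 * uq sq l.+1 ^+ j)
  = tq sq l.+1 ^+ i.+1 - tq sq l ^+ i.+1.
Proof.
have hs := sq_not_root1.
(* The weight in front of the powers of u is exactly t_{l+1} - t_l, the denominator in Binet's
   formula. *)
rewrite -(hrow_binet (tq_add hs l) (tq_mul hs l)) (tq_sub hs).
rewrite -(@hrow_trunc _ _ _ _ n.+1) // big_mkord mulr_sumr.
by apply: eq_bigr => j _; rewrite mxE mulrCA.
Qed.

(* [half]: q^(1/2) is substituted for q. *)
Definition Cmx_half (n : nat) : 'M[F]_n := \matrix_(i, j) cc sq i.+1%:Z j.+1%:Z.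
Definition Dmx_half (n : nat) : 'M[F]_n := \matrix_(i, j) dd sq i.+1%:Z j.+1%:Z.

Lemma ratio_step (K : fieldType) (w y a c u : K) : w != 0 ->
  w / y * (c * (a / (w * y) * u)) = a / (y * y) * (c * u).
Proof. by move=> w0; rewrite !invfM; set y' := y^-1; field. Qed.

Lemma ratio_factor (K : fieldType) (w r r' t t' d : K) :
  t * (w * r / d) - t' * (w * r' / d) = w * (r / d * t - r' / d * t').
Proof. ring. Qed.

Lemma Cmx_step (n : nat) (i : 'I_n) l :
  \sum_j Cmx_half n i j * (qint qq (2 * l.+1) / (qint qq l.+1 * sq ^+ l.+1)
                        * uq sq l.+1 ^+ j.+1)
  = rho sq l.+1 / (1 - sq) * tq sq l.+1 ^+ i.+1
    - rho sq l / (1 - sq) * tq sq l ^+ i.+1.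
Proof.
have hs := sq_not_root1; have hi : (i.+1 < n.+1)%N := ltn_ord i.
(* This factor completes the weight on the left to t_{l+1} - t_l; on the right it is the common
   factor in [tq_rho] and [tq_rho_pred]. *)
have w0 : qint qq l.+1 / sq ^+ l.+1 != 0.
  by rewrite mulf_neq0 ?qint_neq0 ?invr_eq0 ?sqX_neq0.
apply: (mulfI w0).
transitivity ((tq sq l.+1 - tq sq l)
   * \sum_(0 <= m < n.+1) cc sq i.+1 m * uq sq l.+1 ^+ m); last first.
  rewrite (sum_cc (tq_add hs l) (tq_mul hs l)) // (tq_rho hs) (tq_rho_pred hs).
  exact: ratio_factor.
rewrite -big_ord_shift; last first.
  by rewrite /cc /hh2 !hh_neg ?mulr0 ?addr0 ?mul0r //; lia.
rewrite (tq_sub hs) !mulr_sumr; apply: eq_bigr => j _; rewrite !mxE.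
have -> : qnum sq (2 * l.+1) = qint qq (2 * l.+1) by [].
have -> : (sq ^+ 2) ^+ l.+1 = sq ^+ l.+1 * sq ^+ l.+1 by rewrite -exprAC expr2.
exact: ratio_step (qint_neq0 _).
Qed.

(** The alternating sign turns the sum of powers from [sum_gg] into a difference. *)
Lemma Gmx_step (n : nat) (i : 'I_n) l :
  \sum_j Gmx n i j * ((-1) ^+ l.+1 * uq sq l.+1 ^+ j.+1)
  = (-1) ^+ l.+1 * tq sq l.+1 ^+ i.+1 - (-1) ^+ l * tq sq l ^+ i.+1.
Proof.
have hs := sq_not_root1; have hi : (i.+1 < n.+1)%N := ltn_ord i.
rewrite exprS mulN1r mulNr -opprD -mulrDr.
rewrite -(@sum_gg _ _ _ _ _ n.+1 (tq_add hs l) (tq_mul hs l) (tq_sub_neq0 hs l)) //.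
rewrite -big_ord_shift; last by rewrite gg_neg ?mul0r //; lia.
rewrite -mulNr mulr_sumr; apply: eq_bigr => j _; rewrite mxE.
by rewrite mulrCA.
Qed.

Lemma sign_step (K : fieldType) (e w y r r' t t' d : K) : w != 0 -> y != 0 ->
  (-1) * e * (y / w) * (t * (w / y * r / d) + t' * (w / y * r' / d))
  = (-1) * e * r / d * t - e * r' / d * t'.
Proof. by move=> w0 y0; set d' := d^-1; field; rewrite w0 y0. Qed.

(** The weight cancels the common factor in [tq_rho] and [tq_rho_pred]. As t + s u takes up one
    degree in [sum_dd], the power of t is i and not i + 1. *)
Lemma Dmx_step (n : nat) (i : 'I_n) l :
  \sum_j Dmx_half n i j * ((-1) ^+ l.+1 * (sq ^+ l.+1 / qint qq l.+1
                                          * uq sq l.+1 ^+ j.+1))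
  = (-1) ^+ l.+1 * rho sq l.+1 / (1 - sq) * tq sq l.+1 ^+ i
    - (-1) ^+ l * rho sq l / (1 - sq) * tq sq l ^+ i.
Proof.
have hs := sq_not_root1; have hi : (i.+1 < n.+1)%N := ltn_ord i.
transitivity ((-1) ^+ l.+1 * (sq ^+ l.+1 / qint qq l.+1) *
  \sum_(0 <= m < n.+1) dd sq i.+1 m * uq sq l.+1 ^+ m).
  rewrite -big_ord_shift; last by rewrite /dd !gg_neg ?mulr0 ?addr0 ?mul0r //; lia.
  by rewrite mulr_sumr; apply: eq_bigr => j _; rewrite mxE; ring.
rewrite (sum_dd (tq_add hs l) (tq_mul hs l) (tq_sub_neq0 hs l)) //.
rewrite (tq_rho hs) (tq_rho_pred hs).
rewrite [(-1) ^+ l.+1]exprS.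
exact: sign_step (qint_neq0 _) (sqX_neq0 _).
Qed.

(** * The defining identities in terms of t_N *)

Lemma tq_div N : tq sq N = NN N / qq ^+ N. Proof. by []. Qed.

Lemma mul_div_cancel (K : fieldType) (b x y : K) : b != 0 -> b * (x / b / y) = x / y.
Proof. by move=> b0; rewrite mulrA [b * _]mulrC divfK. Qed.

Lemma S_odd_spec P n (j : 'I_n.+1) N : P_spec P -> (0 < N)%N ->
  S_odd j N = \sum_l Pinv P n j l * tq sq N ^+ l.+1.
Proof.
move=> hP hN; rewrite /S_odd hP // mulr_suml mulr_sumr (big_ord_if _ (ltn_ord j)).
apply: eq_bigr => l _; rewrite mxE; case: leqP => lj; last by rewrite mul0r.
have -> : sq ^+ ((2 * j + 1 + 1) * N) = (qq ^+ N) ^+ (j - l + l.+1).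
  have -> : (j - l + l.+1 = j.+1)%N by lia.
  by rewrite /qq -!exprM; congr (_ ^+ _); lia.
rewrite mul_div_cancel ?qint_neq0 // -(mulrA (_ ^+ (j - l))).
by rewrite sign_cancel ?qqX_neq0 // tq_div expr_div_n !mulrA.
Qed.

Definition Qinv_half (Q : nat -> nat -> {poly int}) (n : nat) : 'M[F]_n :=
  \matrix_(i, j) if (j <= i)%N then
      (-1) ^+ (i - j)%N *
      ((1 - sq) ^+ (i - j + 1)%N * ev (Q i.+1 (i - j)%N) sq
       / \prod_(0 <= l < (i - j).+1%N) (1 - sq ^+ (2 * i.+1 - 2 * l + 1)%N))
    else 0.

Definition Hinv_half (H : nat -> nat -> {poly int}) (n : nat) : 'M[F]_n :=
  \matrix_(i, j) if (j <= i)%N then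
      (-1) ^+ (i - j)%N *
      (ev (H i.+1 (i - j)%N) sq
       / ((1 + sq) ^+ (i - j + 1)%N
          * \prod_(0 <= l < (i - j).+1%N) (1 + sq ^+ (2 * i.+1 - 2 * l - 1)%N)))
    else 0.

Lemma div_pull (K : fieldType) (b x S y A : K) :
  b * (x * S / (y * A)) = x / y * (b * (S / A)).
Proof. by rewrite invfM; set y' := y^-1; set A' := A^-1; ring. Qed.

Lemma mul_regroup (K : fieldType) (e z p v t D : K) :
  z * (e * (p * v / D) * t) = e * (z * p * v / D) * t.
Proof. by set D' := D^-1; ring. Qed.

Lemma S_even_spec Q n : Q_spec Q -> exists c : 'I_n -> F, forall (j : 'I_n) N,
  (0 < N)%N ->
  S_even j N = rho sq N / (1 - sq) * (c j + \sum_l Qinv_half Q n j l * tq sq N ^+ l.+1).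
Proof.
move=> hQ.
pose Z (m k : nat) : F := (1 - sq) ^+ (m - k) * ev (Q m (m - k)%N) sq
         / \prod_(0 <= i < (m - k).+1%N) (1 - sq ^+ (2 * (m - i) + 1)%N).
(* This is the k = 0 term. The factor 1 - s offsets the division of [rho] by 1 - s; in the other
   terms it raises the exponent of 1 - s to the one in [Qinv_half]. *)
exists (fun j => (1 - sq) * ((-1) ^+ j.+1 * Z j.+1 0%N)) => j N hN.
rewrite /S_even hQ //.
have -> : sq ^+ ((2 * j.+1 + 1) * N) = sq ^+ N * (qq ^+ N) ^+ j.+1.
  by rewrite /qq -!exprM -exprD; congr (_ ^+ _); lia.
rewrite div_pull -/(rho sq N) -[RHS]mulrA; congr (_ * _).
have E : qint qq 2 * ((\sum_(0 <= k < j.+2)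
      (- qq ^+ N) ^+ (j.+1 - k) * Z j.+1 k * NN N ^+ k / qint qq 2) / (qq ^+ N) ^+ j.+1)
   = \sum_(0 <= k < j.+2) (-1) ^+ (j.+1 - k) * Z j.+1 k * tq sq N ^+ k.
  rewrite mulr_suml mulr_sumr !big_nat; apply: eq_bigr => k /andP[_ hk].
  have -> : (qq ^+ N) ^+ j.+1 = (qq ^+ N) ^+ (j.+1 - k + k) by rewrite subnK.
  rewrite mul_div_cancel ?qint_neq0 // sign_cancel ?qqX_neq0 //.
  by rewrite tq_div expr_div_n.
rewrite E big_nat_recl // subn0 expr0 mulr1 mulrDr mulKf ?subr1_sq //.
congr (_ + _); apply: (canRL (mulKf subr1_sq)).
rewrite (big_ord_if _ (ltn_ord j)) mulr_sumr; apply: eq_bigr => l _; rewrite mxE.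
case: leqP => lj; last by rewrite mulr0 mul0r.
rewrite subSS /Z mul_regroup subSS addn1 -exprS; congr (_ * (_ / _) * _).
by rewrite !big_nat; apply: eq_bigr => i _; rewrite mulnBr.
Qed.

Lemma T_even_spec G n (j : 'I_n) N : G_spec G -> (0 < N)%N ->
  T_even j N = (-1) ^+ N * \sum_l Ginv G n j l * tq sq N ^+ l.+1.
Proof.
move=> hG hN; rewrite /T_even hG //; congr (_ * _).
rewrite mulr_suml big_add1 /= (big_ord_if _ (ltn_ord j)).
apply: eq_bigr => l _; rewrite mxE; case: leqP => lj; last by rewrite mul0r.
have -> : sq ^+ (2 * j.+1 * N) = (qq ^+ N) ^+ (j - l + l.+1).
  have -> : (j - l + l.+1 = j.+1)%N by lia.
  by rewrite /qq -!exprM; congr (_ ^+ _); lia.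
by rewrite subSS sign_cancel ?qqX_neq0 // tq_div expr_div_n.
Qed.

(** Here e is (-1)^N and w A is the normalising power of s. Since e e = 1, the isolated term of the
    identity for H becomes f v / D, free of N. *)
Lemma sign_split (K : fieldType) (e f v D x z S w A : K) :
  e * e = 1 -> w != 0 -> A != 0 -> z != 0 ->
  z * (e * ((f * e * v * (w * A) / D + x / z * S) / (w * A)) - f * v / D)
  = e * (x / w) * (S / A).
Proof.
move=> e2 w0 A0 z0; set D' := D^-1.
have -> : z * (e * ((f * e * v * (w * A) * D' + x / z * S) / (w * A)) - f * v * D')
  = (e * e) * z * f * v * D' + e * (x / w) * (S / A) - z * f * v * D'.
  by field; rewrite A0 w0 z0.
by rewrite e2; ring.
Qed.

Lemma div_regroup (K : fieldType) (p v t D A : K) :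
  p * v * t / D / A = p * (v / D) * t / A.
Proof. by set D' := D^-1; set A' := A^-1; ring. Qed.

Lemma T_odd_spec H n : H_spec H -> exists c : 'I_n -> F, forall (j : 'I_n) N,
  (0 < N)%N ->
  \sum_l Hinv_half H n j l * ((-1) ^+ N * rho sq N * tq sq N ^+ l)
  = (1 - sq) * (T_odd j N - c j).
Proof.
move=> hH; exists (fun j => (-1) ^+ j.+1 * ev (H j.+1 (j.+1 - 1)%N) sq
  / ((1 + sq) ^+ j.+1 * \prod_(0 <= i < j.+1) (1 + sq ^+ (2 * (j.+1 - i) - 1)%N))).
move=> j N hN; rewrite /T_odd hH //.
have -> : sq ^+ ((2 * j.+1 - 1) * N) = sq ^+ N * (qq ^+ N) ^+ j.
  by rewrite /qq -!exprM -exprD; congr (_ ^+ _); lia.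
have e2 : (-1) ^+ N * (-1) ^+ N = 1 :> F by rewrite -expr2 sqrr_sign.
have A0 := expf_neq0 j (qqX_neq0 N).
rewrite exprD (sign_split _ _ _ _ _ e2 (sqX_neq0 N) A0 subr1_sq).
rewrite -/(rho sq N) mulr_suml mulr_sumr big_add1 /= (big_ord_if _ (ltn_ord j)).
apply: eq_bigr => l _; rewrite mxE; case: leqP => lj; last by rewrite mul0r.
rewrite mulrCA subSS; congr (_ * _).
have -> : (qq ^+ N) ^+ j = (qq ^+ N) ^+ (j - l + l) by rewrite subnK.
rewrite subn1 /= div_regroup sign_cancel ?qqX_neq0 // tq_div expr_div_n.
congr (_ * (_ / (_ * _)) * _).
by rewrite !big_nat; apply: eq_bigr => i _; rewrite mulnBr.
Qed.

(** * The matrix products *)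

Lemma tq0 : tq sq 0 = 0.
Proof. by rewrite /tq /qnum expr0 subrr !mul0r. Qed.

Lemma sum_mulfI (K : fieldType) (n : nat) (r t : K) (E : 'I_n -> K) : r != 0 ->
  \sum_j r * E j = r * t -> \sum_j E j = t.
Proof. by move=> r0; rewrite -mulr_sumr; exact: (mulfI r0). Qed.

Lemma Hmx_mul_Pinv n (P : nat -> nat -> {poly int}) : P_spec P ->
  Hmx n *m Pinv P n = 1%:M.
Proof.
move=> hP; apply: (mx_eq1_tq (c := fun=> 0) sq_not_root1) => N i hN.
rewrite add0r sum_mulmx.
under eq_bigr => j _ do rewrite -(S_odd_spec _ hP hN) S_oddE.
rewrite (sum_telescope (Phi := fun l => tq sq l ^+ i.+1)); last exact: Hmx_step.
(* The lower boundary term is a positive power of t_0 = 0. *)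
by rewrite tq0 expr0n subr0.
Qed.

Lemma Cmx_mul_Qinv n Q : Q_spec Q -> Cmx_half n *m Qinv_half Q n = 1%:M.
Proof.
move=> hQ; have [c hc] := S_even_spec n hQ.
apply: (mx_eq1_tq (c := fun i => \sum_j Cmx_half n i j * c j) sq_not_root1) => N i hN.
rewrite sum_mulmx -big_split /=.
have r0 : rho sq N / (1 - sq) != 0.
  exact: mulf_neq0 (rho_neq0 N) (invr_neq0 subr1_sq).
apply: (sum_mulfI r0).
under eq_bigr => j _ do rewrite -mulrDr mulrCA -(hc _ _ hN) S_evenE.
rewrite (sum_telescope (Phi := fun l => rho sq l / (1 - sq) * tq sq l ^+ i.+1)).
  by rewrite tq0 expr0n mulr0 subr0.
exact: Cmx_step.
Qed.

Lemma Gmx_mul_Ginv n G : G_spec G -> Gmx n *m Ginv G n = 1%:M.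
Proof.
move=> hG; apply: (mx_eq1_tq (c := fun=> 0) sq_not_root1) => N i hN.
rewrite add0r sum_mulmx.
have e0 : (-1) ^+ N != 0 :> F by rewrite signr_eq0.
apply: (sum_mulfI e0).
under eq_bigr => j _ do rewrite mulrCA -(T_even_spec _ hG hN) T_evenE.
rewrite (sum_telescope (Phi := fun l => (-1) ^+ l * tq sq l ^+ i.+1)).
  by rewrite tq0 expr0n mulr0 subr0.
exact: Gmx_step.
Qed.

Lemma Dmx_mul_Hinv n H : H_spec H -> Dmx_half n *m Hinv_half H n = 1%:M.
Proof.
move=> hH; have [c hc] := T_odd_spec n hH.
pose Phi i l := (-1) ^+ l * rho sq l / (1 - sq) * tq sq l ^+ i.
apply: (mx_eq1_rho (s := sq)
  (* The power of t may be 0 here, so the lower boundary term can survive; it joins the constants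
     coming from the identity for H. *)
  (c := fun i => - ((1 - sq) * (Phi i 0%N + \sum_j Dmx_half n i j * c j)))
  sq_not_root1).
move=> N i hN; rewrite sum_mulmx.
under eq_bigr => j _ do rewrite hc // mulrCA mulrBr T_oddE.
rewrite -mulr_sumr sumrB.
rewrite (sum_telescope (Phi := Phi i)); last exact: Dmx_step.
rewrite -addrA -opprD mulrBr; congr (_ - _).
by rewrite /Phi [_ / _ * _]mulrAC mulrC divfK ?subr1_sq.
Qed.

Lemma is_inverse_mul1 m (A B : 'M[F]_m) : A *m B = 1%:M -> is_inverse A B.
Proof. by move=> h; split=> //; exact: mulmx1C. Qed.

Theorem theorem2p3 (n : nat) (P Q G H : nat -> nat -> {poly int}) :
  (1 <= n)%N -> P_spec P -> Q_spec Q -> G_spec G -> H_spec H ->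
  [/\ is_inverse (Hmx n) (Pinv P n),
      is_inverse (Cmx n) (Qinv Q n),
      is_inverse (Gmx n) (Ginv G n)
    & is_inverse (Dmx n) (Hinv H n)].
Proof.
move=> _ hP hQ hG hH; have [phi phiE] := sq_substitution.
split; apply: is_inverse_mul1; [exact: Hmx_mul_Pinv| |exact: Gmx_mul_Ginv|].
(* Applied entrywise, [phi] sends s to q and turns the half matrices into [Cmx] and [Qinv]. *)
- have := congr1 (map_mx phi) (Cmx_mul_Qinv n hQ); rewrite map_mxM map_mx1 => <-.
  congr (_ *m _); apply/matrixP => i j; rewrite !mxE.
    by rewrite rmorph_cc phiE.
  case: ifP => _; last by rewrite rmorph0.
  rewrite !rmorphM rmorph_sign fmorphV rmorphXn rmorphB rmorph1.
  rewrite rmorph_ev rmorph_prod phiE.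
  congr (_ * (_ / _)); apply: eq_bigr => l _.
  by rewrite rmorphB rmorph1 rmorphXn /= phiE.
- have := congr1 (map_mx phi) (Dmx_mul_Hinv n hH); rewrite map_mxM map_mx1 => <-.
  congr (_ *m _); apply/matrixP => i j; rewrite !mxE.
    by rewrite rmorph_dd phiE.
  case: ifP => _; last by rewrite rmorph0.
  rewrite !rmorphM rmorph_sign fmorphV rmorphM rmorphXn rmorphD rmorph1.
  rewrite rmorph_ev rmorph_prod phiE.
  congr (_ * (_ / (_ * _))); apply: eq_bigr => l _.
  by rewrite rmorphD rmorph1 rmorphXn /= phiE.
Qed.
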